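(* For $n\geq 3$, let $$A(n)=\left\{(r,v)\in \mathbb{N}^{2} \mid 1\leq r<\tfrac{n}{2},\ 1\leq v\leq r-\left\lceil\tfrac{r}{n-2r}\right\rceil+1\right\},\quad B(n)=\left\{(r,v)\in\mathbb{N}^2 \mid 1\leq r<\tfrac{n}{2},\ 1\leq v<\tfrac{n}{2}\right\}.$$ Then $A(n)\subseteq \mathcal{RV}(n)\subseteq B(n)$.
   Context: For a simple graph $G$ on vertices $x_1,\dots,x_n$, let $R=K[x_1,\dots,x_n]$ ($K$ a field) and $I(G)=\langle x_ix_j\mid \{x_i,x_j\}\in E(G)\rangle$. Write $\operatorname{reg}(G)=\operatorname{reg}(R/I(G))$ (Castelnuovo–Mumford regularity) and $\mathrm{v}(G)$ for the v-number of $I(G)$, which equals $\min\{|A| : A \text{ independent in } G,\ N_G(A) \text{ a vertex cover of } G\}$, where $N_G(A)$ is the set of neighbours of vertices of $A$. Define $\mathcal{RV}(n)=\{(r,v)\in\mathbb{N}^2 \mid \text{there is a connected simple graph } G \text{ on } n \text{ vertices with } \operatorname{reg}(G)=r,\ \mathrm{v}(G)=v\}$. *)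

(* Defs.v *)
From HB Require Import structures.
From mathcomp Require Import all_boot all_order all_algebra.
Set Implicit Arguments. Unset Strict Implicit. Unset Printing Implicit Defensive.
Import GRing.Theory Num.Theory.

Definition simple_graph (n : nat) (e : rel 'I_n) : Prop :=
  (forall x y, e x y = e y x) /\ (forall x, ~~ e x x).

Definition connected_graph (n : nat) (e : rel 'I_n) : Prop :=
  forall x y, connect e x y.

Definition independent (n : nat) (e : rel 'I_n) (A : {set 'I_n}) : bool :=
  [forall x in A, forall y in A, ~~ e x y].

Definition nbhd (n : nat) (e : rel 'I_n) (A : {set 'I_n}) : {set 'I_n} :=
  [set y | [exists x in A, e x y]].

Definition vertex_cover (n : nat) (e : rel 'I_n) (C : {set 'I_n}) : bool :=
  [forall x, forall y, e x y ==> (x \in C) || (y \in C)].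

Definition is_vnumber (n : nat) (e : rel 'I_n) (v : nat) : Prop :=
  (exists A : {set 'I_n},
      [/\ independent e A, vertex_cover e (nbhd e A) & #|A| = v]) /\
  (forall A : {set 'I_n},
      independent e A -> vertex_cover e (nbhd e A) -> v <= #|A|).

(* ---------- graded Betti numbers of R/I(G) via Tor_i^R(K, R/I(G))_j ----------
   computed by the Koszul complex K(x_1..x_n) (x) R/I(G), degree j strand.
   A K-basis of K_i (x) R/I(G) in degree j: e_S * m with |S| = i, m a monomial
   (exponent vector) not in I(G) (standard monomial) and |S| + deg m = j. *)
Definition standard_mon (n d : nat) (e : rel 'I_n) (m : {ffun 'I_n -> 'I_d}) : bool :=
  [forall x, forall y, e x y ==> ((m x == 0 :> nat) || (m y == 0 :> nat))].

Definition kbasis_pred (n : nat) (e : rel 'I_n) (i j : nat)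
    (p : {set 'I_n} * {ffun 'I_n -> 'I_j.+1}) : bool :=
  [&& #|p.1| == i, #|p.1| + \sum_(k < n) (p.2 k : nat) == j & standard_mon e p.2].

Arguments kbasis_pred {n} e i j p.

Definition kbasis (n : nat) (e : rel 'I_n) (i j : nat) : finType :=
  {p : {set 'I_n} * {ffun 'I_n -> 'I_j.+1} | kbasis_pred e i j p}.

(* Koszul differential  d(e_S m) = sum_{s in S} (-1)^{#{t in S | t < s}} x_s m e_{S\s},
   from degree-j part of K_{i+1}(x) R/I to K_i (x) R/I (terms x_s m in I vanish). *)
Definition koszul_mx (K : fieldType) (n : nat) (e : rel 'I_n) (i j : nat) :
    'M[K]_(#|{: kbasis e i.+1 j}|, #|{: kbasis e i j}|) :=
  \matrix_(r, c)
    let p := val (enum_val r : kbasis e i.+1 j) in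
    let q := val (enum_val c : kbasis e i j) in
    (\sum_(s in p.1)
      (if (q.1 == p.1 :\ s) && [forall k, (q.2 k : nat) == ((p.2 k : nat) + (k == s))%N]
       then (-1) ^+ #|[set t in p.1 | (t < s)%N]| else 0))%R.

Definition koszul_rank (K : fieldType) (n : nat) (e : rel 'I_n) (i j : nat) : nat :=
  if i is i'.+1 then \rank (koszul_mx K e i' j) else 0.

(* beta_{i,j}(R/I(G)) = dim_K H_i(K(x) (x) R/I(G))_j = dim_K Tor_i^R(K, R/I(G))_j *)
Definition betti (K : fieldType) (n : nat) (e : rel 'I_n) (i j : nat) : nat :=
  #|{: kbasis e i j}| - koszul_rank K e i j - koszul_rank K e i.+1 j.

Definition is_reg (K : fieldType) (n : nat) (e : rel 'I_n) (r : nat) : Prop :=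
  (exists i j, betti K e i j != 0 /\ j = i + r) /\
  (forall i j, betti K e i j != 0 -> j <= i + r).

Definition RV (K : fieldType) (n r v : nat) : Prop :=
  exists e : rel 'I_n,
    [/\ simple_graph e, connected_graph e, is_reg K e r & is_vnumber e v].

Definition ceil_div (a b : nat) : nat := (a + b.-1) %/ b.

Definition setA (n r v : nat) : Prop :=
  [/\ 1 <= r, 2 * r < n, 1 <= v & v <= r - ceil_div r (n - 2 * r) + 1].

Definition setB (n r v : nat) : Prop :=
  [/\ 1 <= r, 2 * r < n, 1 <= v & 2 * v < n].

(* Main.v *)
Require Import Defs.
From mathcomp Require Import all_boot all_order all_algebra ring zify.

(** Fixing a multidegree [mu] with support [P], the strand of the Koszul complex
    of R/I(G) is, after replacing an exterior part S by T = P \ S, the cochain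
    complex of the independence complex of G[P] if [mu] is squarefree, and of a
    cone otherwise.  So reg(G) <= k as soon as all these complexes have no
    cohomology on faces of more than k vertices, which follows by deleting a vertex
    x and taking its link G \ N[x].  When G is connected with n >= 3, a vertex of
    degree at least two makes n drop by three in the link, whence reg(G) < n/2;
    the same greedy step (add x, pass to G \ N[x]) gives v(G) < n/2.

    Conversely, for (r,v) in A(n) put a = r - v + 1, take a clique on n - 2r hubs
    and r pendant paths hub - foot - tip, every hub being joined to between 1 and a
    feet, one of them to exactly a.  The r foot-tip edges form an induced matching,
    so reg >= r; eliminating the hubs gives reg <= r.  A witness of the v-number
    meets every foot-tip edge not dominated by its unique hub, so v = r - a + 1. *)

Set Implicit Arguments. Unset Strict Implicit. Unset Printing Implicit Defensive.
Import GRing.Theory Num.Theory.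
Local Open Scope ring_scope.

(** * Augmented simplicial cochains and exactness *)

Section Cochains.
Variables (K : fieldType) (n : nat).
Implicit Types (s t x : 'I_n) (S T W : {set 'I_n}) (b c : {set 'I_n} -> K).

Definition sgn s T : K := (-1) ^+ #|[set t in T | (t < s)%N]|.

(** Cochains are functions on all vertex sets, the restriction to faces being left to [exact_at].
    The empty set counts as a face, so the complex is the augmented one. *)
Definition cobd c T : K := \sum_(s in T) sgn s T * c (T :\ s).

Lemma sgn_sq s T : sgn s T * sgn s T = 1.
Proof. by rewrite -expr2 sqrr_sign. Qed.

Lemma sgn_setU1 s x T : x \notin T ->
  sgn s (x |: T) = (-1) ^+ (x < s)%N * sgn s T.
Proof.
move=> xT; rewrite /sgn -exprD; congr (_ ^+ _).
rewrite (cardsD1 x) !inE eqxx /=; congr (_ + _)%N.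
apply: eq_card => t; rewrite !inE.
by case: eqP => //= ->; rewrite (negbTE xT).
Qed.

Lemma sgn_setD1 s x T : x \in T ->
  sgn s (T :\ x) = (-1) ^+ (x < s)%N * sgn s T.
Proof.
move=> xT; rewrite -{2}(setD1K xT) sgn_setU1 ?setD11 // mulrA.
by rewrite -expr2 sqrr_sign mul1r.
Qed.

Lemma cobd_setU1 c x T : x \notin T ->
  cobd c (x |: T) = sgn x T * c T +
    \sum_(s in T) (-1) ^+ (x < s)%N * sgn s T * c (x |: (T :\ s)).
Proof.
move=> xT; rewrite /cobd big_setU1 //= setU1K // sgn_setU1 // ltnn mul1r.
congr (_ + _); apply: eq_bigr => s sT; rewrite sgn_setU1 //.
congr (_ * c _); apply/setP => t; rewrite !inE.
case: (eqVneq t x) => [->|] /=; last by [].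
by rewrite andbT; case: eqP => // xs; rewrite xs sT in xT.
Qed.

Lemma eq_cobd c b T : (forall s, s \in T -> c (T :\ s) = b (T :\ s)) -> cobd c T = cobd b T.
Proof. by move=> cb; apply: eq_bigr => s /cb ->. Qed.

Lemma cobdB c b T : cobd (fun U => c U - b U) T = cobd c T - cobd b T.
Proof. by rewrite -sumrB; apply: eq_bigr => s _; rewrite mulrBr. Qed.

(** Removing [s] and [u] in either order reaches the same set with opposite signs, because only the
    larger of the two has its sign changed when the other is removed. *)
Lemma cobd_cobd c T : cobd (cobd c) T = 0.
Proof.
pose G s u := sgn s T * (sgn u (T :\ s) * c (T :\ s :\ u)).
transitivity (\sum_(s in T) (\sum_(u in T | (u < s)%N) G s u +
                             \sum_(u in T | (s < u)%N) G s u)).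
  apply: eq_bigr => s sT; rewrite [cobd _ _]/cobd big_distrr /=.
  rewrite (bigID (fun u : 'I_n => (u < s)%N)) /=; congr (_ + _); apply: eq_bigl => u;
    rewrite !inE -!val_eqE /=; case: (u \in T); rewrite ?andbF //= ?andbT;
    by rewrite andbC; case: ltngtP.
rewrite big_split /=.
have -> : \sum_(s in T) \sum_(u in T | (s < u)%N) G s u =
          \sum_(s in T) \sum_(u in T | (u < s)%N) G u s.
  rewrite (exchange_big_dep (mem T)) /=; last by move=> s u _ /andP[].
  by apply: eq_bigr => s sT; apply: eq_bigl => u; rewrite sT.
rewrite -big_split big1 //= => s sT; rewrite -big_split big1 //= => u /andP[uT us].
have Duu : T :\ s :\ u = T :\ u :\ s by rewrite !setDDl setUC.
rewrite /G Duu !sgn_setD1 // us (ltnNge s u) (ltnW us) expr0 expr1; ring.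
Qed.

(** Vanishing of reduced cohomology in dimension [t - 1]: the degree [t] counts vertices. *)
Definition exact_at (F : pred {set 'I_n}) (t : nat) : Prop :=
  forall c, (forall T, F T -> #|T| = t.+1 -> cobd c T = 0) ->
  exists b, forall T, F T -> #|T| = t -> c T = cobd b T.

Definition down_closed (F : pred {set 'I_n}) : Prop :=
  forall S T, S \subset T -> F T -> F S.

(** The contracting homotopy [b] with apex [x] is by construction a primitive of [c] on every set
    containing [x]. For a face [T] avoiding [x], the cocycle condition at [x |: T] leaves only the
    difference of [c] and [cobd b] at [T]. *)
Lemma exact_cone (F : pred {set 'I_n}) x (t : nat) :
  (forall T, F T -> F (x |: T)) -> exact_at F t.
Proof.
move=> Fx c cocyc.
pose b T := if x \in T then 0 else sgn x T * c (x |: T).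
have bx T : x \in T -> c T = cobd b T.
  move=> xT; rewrite -(setD1K xT) cobd_setU1 ?setD11 // big1 ?addr0.
    by rewrite /b setD11 mulrA sgn_sq mul1r.
  by move=> s _; rewrite /b setU11 mulr0.
exists b => T FT cT; case: (boolP (x \in T)) => [/bx //|xT].
have := cocyc _ (Fx _ FT); rewrite cardsU1 xT cT => /(_ erefl).
rewrite -[cobd c _]subr0 -(cobd_cobd b (x |: T)) -cobdB cobd_setU1 //.
rewrite big1 ?addr0; last by move=> s _; rewrite -bx ?setU11 // subrr mulr0.
rewrite cobd_cobd; move/(congr1 ( *%R (sgn x T))); rewrite mulr0 mulrA sgn_sq mul1r.
by move/eqP; rewrite subr_eq0 => /eqP.
Qed.

(** A segment of the long exact sequence of deletion and link, made explicit. Once the coboundary of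
    a primitive on the deletion is subtracted, the remainder [c1] vanishes on the faces avoiding
    [x], hence is a cochain of the link one degree lower. *)
Lemma exact_del_link (F : pred {set 'I_n}) x (t : nat) :
  down_closed F ->
  exact_at (fun T => (x \notin T) && F T) t.+1 ->
  exact_at (fun T => (x \notin T) && F (x |: T)) t ->
  exact_at F t.+1.
Proof.
move=> dF ex_del ex_link c cocyc.
have [T /andP[_ FT]|b0 b0P] := ex_del c; first exact: cocyc.
pose b T := if x \in T then 0 else b0 T.
pose c1 T := c T - cobd b T.
have c1F T : F T -> #|T| = t.+1 -> x \notin T -> c1 T = 0.
  move=> FT cT xT; rewrite /c1 b0P ?xT // (@eq_cobd b0 b) ?subrr // => s sT.
  by rewrite /b inE (negbTE xT) andbF.
have c1cocyc T : F T -> #|T| = t.+2 -> cobd c1 T = 0.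
  by move=> FT cT; rewrite cobdB cobd_cobd cocyc // subrr.
(* [tau] absorbs the sign that moving [x] to the front of a face produces. *)
pose tau T : K := (-1) ^+ #|[set u in T | (x < u)%N]|.
have tau_sq T : tau T * tau T = 1 by rewrite -expr2 sqrr_sign.
have tauD s T : s \in T -> tau (T :\ s) = (-1) ^+ (x < s)%N * tau T.
  move=> sT; rewrite /tau [in RHS](cardsD1 s) !inE sT /= exprD mulrA -expr2.
  rewrite sqrr_sign mul1r; congr (_ ^+ _); apply: eq_card => u; rewrite !inE.
  by rewrite andbA.
pose c2 T := tau T * c1 (x |: T).
have c2E a T : x \notin T ->
    cobd (fun U => tau U * a (x |: U)) T =
    tau T * (cobd a (x |: T) - sgn x T * a T).
  move=> xT; rewrite cobd_setU1 // [_ + \sum_(_ in _) _]addrC addrK big_distrr.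
  by apply: eq_bigr => s sT /=; rewrite tauD //; ring.
have [T /andP[xT FT] cT|b2 b2P] := ex_link c2.
  rewrite c2E // c1cocyc ?cardsU1 ?xT ?cT // c1F ?mulr0 ?subr0 ?mulr0 //.
  by apply: dF FT; apply: subsetUr.
(* The primitive on the link is carried to the sets through [x]. It is zero on the others, so the
   values already settled there are not disturbed. *)
pose b3 T := if x \in T then tau (T :\ x) * b2 (T :\ x) else 0.
exists (fun T => b T + b3 T) => T FT cT.
rewrite -[cobd _ _]addr0 -[in RHS](subrr (cobd b T)) addrA addrAC -cobdB.
rewrite (@eq_cobd _ b3); last by move=> s _; rewrite addrC addKr.
apply/eqP; rewrite -subr_eq -/(c1 T); apply/eqP.
case: (boolP (x \in T)) => [xT|xT]; last first.
  rewrite c1F // /cobd big1 // => s sT.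
  by rewrite /b3 inE (negbTE xT) andbF mulr0.
have xD := setD11 x T.
have := b2P (T :\ x); rewrite xD setD1K // FT.
have -> : #|T :\ x| = t by move: cT; rewrite (cardsD1 x) xT => -[].
move=> /(_ isT erefl).
rewrite (@eq_cobd _ (fun U => tau U * b3 (x |: U))); last first.
  move=> s sT; rewrite /b3 setU11 setU1K ?mulrA ?tau_sq ?mul1r //.
by rewrite !inE eqxx andbF.
rewrite c2E ?xD // {2}/b3 xD mulr0 subr0 setD1K // /c2 setD1K //.
by move/(congr1 ( *%R (tau (T :\ x)))); rewrite !mulrA tau_sq !mul1r.
Qed.

End Cochains.

(** * Cohomology of independence complexes of induced subgraphs *)

Section IndependenceComplex.
Variables (K : fieldType) (n : nat) (e : rel 'I_n).
Hypothesis e_simple : simple_graph e.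
Implicit Types (x y : 'I_n) (T W : {set 'I_n}).

Definition ind_complex W : pred {set 'I_n} :=
  fun T => (T \subset W) && independent e T.

Definition closed_nbhd x : {set 'I_n} := x |: [set y | e x y].

(** By Hochster's formula the Betti number at [(i, j)] collects such cohomology groups with
    [t = j - i], so this vanishing for all [W] bounds the regularity by [k]. *)
Definition cohom_vanish W (k : nat) : Prop :=
  forall t, (k < t)%N -> exact_at K (ind_complex W) t.

Lemma independentP T :
  reflect {in T &, forall x y, ~~ e x y} (independent e T).
Proof.
apply: (iffP forall_inP) => [ind x y xT yT|ind x xT].
  exact: (forall_inP (ind x xT)).
by apply/forall_inP => y; apply: ind.
Qed.

Lemma independentU1 x T :
  independent e (x |: T) = independent e T && [disjoint [set y | e x y] & T].
Proof.
have [sym irr] := e_simple; apply/independentP/andP => [ind|[]].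
  split; first by apply/independentP => y z yT zT; apply: ind; rewrite inE ?yT ?zT orbT.
  rewrite disjoints_subset; apply/subsetP => y; rewrite !inE => exy.
  by apply: contraL exy => yT; apply: ind; rewrite !inE ?eqxx ?yT ?orbT.
move=> /independentP ind dis y z.
have nx u : u \in T -> ~~ e x u.
  by move=> uT; apply/negP => exu; have /negP[] := disjointFl dis uT; rewrite inE.
rewrite !inE => /predU1P[->|yT] /predU1P[->|zT] //; rewrite ?nx //.
  by rewrite sym nx.
exact: ind.
Qed.

Lemma ind_complex_down W : down_closed (ind_complex W).
Proof.
move=> S T ST /andP[TW /independentP ind]; rewrite /ind_complex (subset_trans ST) //=.
by apply/independentP => x y xS yS; apply: ind; apply: (subsetP ST).
Qed.

Lemma eq_exact_at (F F' : pred {set 'I_n}) t :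
  F =1 F' -> exact_at K F t -> exact_at K F' t.
Proof.
move=> FF' ex c cocyc; have [T FT|b bP] := ex c; first by apply: cocyc; rewrite -FF'.
by exists b => T; rewrite -FF'; apply: bP.
Qed.

Lemma disjoint_closed_nbhd x T :
  [disjoint closed_nbhd x & T] = (x \notin T) && [disjoint [set y | e x y] & T].
Proof. by rewrite !disjoints_subset subUset sub1set inE. Qed.

(** The link of [x] in the complex of [W] is the complex of [W :\: closed_nbhd x]. This is the
    cohomological form of reg(G) <= max(reg(G - x), reg(G - N[x]) + 1). *)
Lemma cohom_vanish_vertex W x k : x \in W ->
  cohom_vanish (W :\ x) k.+1 -> cohom_vanish (W :\: closed_nbhd x) k ->
  cohom_vanish W k.+1.
Proof.
move=> xW del link [//|t] kt; apply: (@exact_del_link _ _ _ x).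
- exact: ind_complex_down.
- apply: eq_exact_at (del _ kt) => T; rewrite /ind_complex subsetD1 andbA.
  by congr (_ && _); rewrite andbC.
- apply: eq_exact_at (link _ kt) => T; rewrite /ind_complex independentU1.
  rewrite subUset sub1set xW subsetD disjoint_sym disjoint_closed_nbhd.
  by rewrite /=; do !case: (_ \subset _); do !case: (independent _ _); rewrite ?andbF ?andbT.
Qed.

Lemma cohom_vanish_edgeless W k :
  {in W &, forall x y, ~~ e x y} -> cohom_vanish W k.
Proof.
move=> edgeless t kt; have [->|[x xW]] := set_0Vmem W.
  (* The only face is empty while [t] is positive, so any cochain serves as primitive. *)
  move=> c _; exists c => T; rewrite /ind_complex subset0 => /andP[/eqP-> _].
  by rewrite cards0 => t0; rewrite -t0 in kt.
apply: (@exact_cone _ _ _ x) => T /andP[TW _].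
have TxW : x |: T \subset W by rewrite subUset sub1set xW.
rewrite /ind_complex TxW; apply/independentP => y z yT zT.
by apply: edgeless; apply: (subsetP TxW).
Qed.

Lemma subset_card_closed_nbhd W x (N : {set 'I_n}) :
  N \subset W -> N \subset closed_nbhd x -> (#|W :\: closed_nbhd x| + #|N| <= #|W|)%N.
Proof.
move=> NW Nx; rewrite -(cardsID (closed_nbhd x) W) addnC leq_add2r.
by apply: subset_leq_card; rewrite subsetI NW.
Qed.

(** Branching on an endpoint [x] of an edge, the link loses at least two vertices for one unit of
    [k], while the deletion keeps [k] with one vertex less. *)
Lemma cohom_vanish_card W k : (#|W| <= k.*2.+1)%N -> cohom_vanish W k.
Proof.
have [m] := ubnP #|W|; elim: m => // m IHm in W k *; rewrite ltnS => Wm Wk.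
case: (boolP [forall x in W, forall y in W, ~~ e x y]) => [edgeless|].
  apply: cohom_vanish_edgeless => x y xW yW.
  exact: (forall_inP (forall_inP edgeless x xW)).
case/forall_inPn => x xW /forall_inPn[y yW]; rewrite negbK => exy.
have xy : x != y by apply: contraTneq exy => ->; have [_ ->] := e_simple.
have cD : #|W :\ x| = #|W|.-1 by rewrite (cardsD1 x W) xW.
have cL : (#|W :\: closed_nbhd x| <= #|W| - 2)%N.
  have := @subset_card_closed_nbhd W x [set x; y].
  rewrite cards2 xy !subUset !sub1set xW yW !inE exy eqxx orbT => /(_ isT isT).
  by move=> c2; rewrite -[X in (X <= _)%N](addnK 2); apply: leq_sub2r.
have cW : (1 < #|W|)%N.
  have := @subset_leq_card _ [set x; y] W; rewrite cards2 xy; apply.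
  by rewrite subUset !sub1set xW.
case: k => [|k] in Wk *; first by lia.
apply: (cohom_vanish_vertex xW); apply: IHm; rewrite ?cD.
- by lia.
- by lia.
- by apply: leq_ltn_trans cL _; lia.
- by apply: leq_trans cL _; lia.
Qed.

(** One vertex more than in [cohom_vanish_card] is allowed, which matters only for the full vertex
    set. There the link of [x] loses three vertices for one unit of [k]. *)
Lemma cohom_vanish_degree2 W k x y z : (0 < k)%N -> (n <= k.*2.+2)%N ->
  y != z -> e x y -> e x z -> cohom_vanish W k.
Proof.
case: k => // k _ nk yz exy exz.
have xy : x != y by apply: contraTneq exy => ->; have [_ ->] := e_simple.
have xz : x != z by apply: contraTneq exz => ->; have [_ ->] := e_simple.
have WT := subset_leq_card (subsetT W); rewrite cardsT card_ord in WT.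
case: (ltnP #|W| n) => Wn; first by apply: cohom_vanish_card; lia.
have {}WT : W = setT.
  by apply/eqP; rewrite eqEcard subsetT cardsT card_ord Wn.
have xW : x \in W by rewrite WT inE.
have cD : #|W :\ x| = #|W|.-1 by rewrite (cardsD1 x W) xW.
have cL : (#|W :\: closed_nbhd x| <= #|W| - 3)%N.
  have := @subset_card_closed_nbhd W x (x |: [set y; z]).
  rewrite WT subsetT !subUset !sub1set !inE exy exz eqxx !orbT => /(_ isT isT).
  rewrite cardsU1 !inE negb_or xy xz cards2 yz.
  by move=> c2; rewrite -[X in (X <= _)%N](addnK 3); apply: leq_sub2r.
have cW : #|W| = n by rewrite WT cardsT card_ord.
apply: (cohom_vanish_vertex xW); apply: cohom_vanish_card; rewrite ?cD.
- by lia.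
- by apply: leq_trans cL _; lia.
Qed.

End IndependenceComplex.

(** * Multigraded strands of the Koszul complex *)

Section KoszulStrand.
Variables (K : fieldType) (n : nat) (e : rel 'I_n) (j : nat).
Implicit Types (s x y : 'I_n) (S T W : {set 'I_n}) (m mu : {ffun 'I_n -> 'I_j.+1}).
Local Notation cell := ({set 'I_n} * {ffun 'I_n -> 'I_j.+1})%type.
Implicit Types (f g : cell -> K) (p q : cell).

Definition supp mu : {set 'I_n} := [set k | (0 < mu k)%N].

Definition lower mu S : {ffun 'I_n -> 'I_j.+1} := [ffun k => inord (mu k - (k \in S))].

(** On a Koszul basis element of degree [j] every exponent is at most [j], so [inord] truncates
    nothing there. *)
Definition multideg p : {ffun 'I_n -> 'I_j.+1} := [ffun k => inord (p.2 k + (k \in p.1))].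

(* The Koszul basis element of multidegree [mu] whose exterior part is [supp mu :\: T]. *)
Definition cell_at mu T : cell := (supp mu :\: T, lower mu (supp mu :\: T)).

Definition strand mu : pred {set 'I_n} :=
  fun T => (T \subset supp mu) && standard_mon e (cell_at mu T).2.

Lemma lowerE mu S k : lower mu S k = (mu k - (k \in S))%N :> nat.
Proof. by rewrite ffunE inordK // ltnS (leq_trans (leq_subr _ _)) // -ltnS. Qed.

Lemma lower_cell_gt0 mu T k :
  T \subset supp mu -> (0 < (cell_at mu T).2 k)%N = (k \in T) || (1 < mu k)%N.
Proof.
move=> TP; rewrite lowerE !inE; case: (boolP (k \in T)) => kT /=.
  by have := subsetP TP _ kT; rewrite inE subn0.
by case: (mu k : nat) => [|[|d]].
Qed.

Lemma standard_monP m :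
  reflect {in supp m &, forall x y, ~~ e x y} (standard_mon e m).
Proof.
apply: (iffP forallP) => [std x y|std x].
  rewrite !inE => mx my; apply/negP => exy; have := forallP (std x) y.
  by rewrite exy (gtn_eqF mx) (gtn_eqF my).
apply/forallP => y; apply/implyP => exy.
rewrite !eqn0Ngt -negb_and; apply: contraL exy => /andP[mx my].
by apply: std; rewrite inE.
Qed.

(** Shrinking [T] moves variables into the exterior part, which replaces the monomial by a divisor;
    divisors of standard monomials are standard. *)
Lemma strand_sub mu S T : S \subset T -> strand mu T -> strand mu S.
Proof.
move=> ST /andP[TP /standard_monP std]; have SP := subset_trans ST TP.
rewrite /strand SP; apply/standard_monP => x y; rewrite !inE !lower_cell_gt0 // => xS yS.
by apply: std; rewrite inE lower_cell_gt0 //;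
   [case/orP: xS => [/(subsetP ST)->//|->] | case/orP: yS => [/(subsetP ST)->//|->]];
   rewrite orbT.
Qed.

Lemma sum_multideg mu S :
  S \subset supp mu -> (#|S| + \sum_k lower mu S k = \sum_k mu k)%N.
Proof.
move=> SP; rewrite -sum1_card [X in (X + _)%N]big_mkcond -big_split /=.
apply: eq_bigr => k _; rewrite lowerE; case: (boolP (k \in S)) => kS.
  by have := subsetP SP _ kS; rewrite inE => mk; rewrite addnC subnK.
by rewrite subn0.
Qed.

Lemma cell_at_kbasis i mu T : strand mu T -> (\sum_k mu k = j)%N ->
  #|supp mu :\: T| = i -> kbasis_pred e i j (cell_at mu T).
Proof.
move=> /andP[TP std] mu_j cT; rewrite /kbasis_pred std cT eqxx /=.
by rewrite -cT sum_multideg ?subsetDl // mu_j eqxx.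
Qed.

Lemma multideg_cell_at mu T : multideg (cell_at mu T) = mu.
Proof.
apply/ffunP => k; apply: val_inj; rewrite ffunE [RHS]/= lowerE /= subnK.
  by rewrite inord_val.
by case: (boolP (k \in _)) => //; rewrite !inE => /andP[].
Qed.

Lemma multidegE i p k : kbasis_pred e i j p ->
  multideg p k = (p.2 k + (k \in p.1))%N :> nat.
Proof.
case/and3P=> _ /eqP p_j _; rewrite ffunE inordK // ltnS -[leqRHS]p_j addnC.
apply: leq_add; last by rewrite (bigD1 k) //= leq_addr.
by case: (boolP (k \in _)) => // kp; rewrite (cardsD1 k) kp.
Qed.

Lemma sum_multideg_kbasis i p : kbasis_pred e i j p -> (\sum_k multideg p k = j)%N.
Proof.
move=> pP; under eq_bigr do rewrite (multidegE _ pP).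
rewrite big_split /= addnC -big_mkcond sum1_card.
by case/and3P: pP => _ /eqP.
Qed.

Lemma supp_multideg i p : kbasis_pred e i j p -> supp (multideg p) = p.1 :|: supp p.2.
Proof.
move=> pP; apply/setP => k; rewrite !inE (multidegE _ pP) addn_gt0 orbC.
by case: (k \in _).
Qed.

Lemma cell_at_multideg i p : kbasis_pred e i j p ->
  cell_at (multideg p) (supp (multideg p) :\: p.1) = p.
Proof.
move=> pP; have sub : p.1 \subset supp (multideg p).
  by rewrite (supp_multideg pP) subsetUl.
rewrite /cell_at setDDr setDv set0U (setIidPr sub); case: p pP {sub} => S m /= pP.
congr (_, _); apply/ffunP => k; apply: val_inj.
by rewrite /= lowerE (multidegE _ pP) addnK.
Qed.

Lemma strand_multideg i p : kbasis_pred e i j p ->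
  strand (multideg p) (supp (multideg p) :\: p.1).
Proof.
move=> pP; rewrite /strand subsetDl (cell_at_multideg pP).
by case/and3P: pP.
Qed.

Definition chain_row i f : 'rV[K]_#|{: kbasis e i j}| :=
  \row_k f (val (enum_val k : kbasis e i j)).

Lemma chain_rowE i f (q : kbasis e i j) : chain_row i f 0 (enum_rank q) = f (val q).
Proof. by rewrite mxE enum_rankK. Qed.

Lemma chain_row_surj i (v : 'rV[K]_#|{: kbasis e i j}|) : exists f, v = chain_row i f.
Proof.
exists (fun p => if insub p is Some b then v 0 (enum_rank (b : kbasis e i j)) else 0).
by apply/rowP => k; rewrite mxE valK enum_valK.
Qed.

(* The sign that turns the Koszul differential on exterior parts [S] into the
   cochain differential on the complements [T = supp mu :\: S]. *)
Definition gauge W T : K := \prod_(s in T) sgn K s W.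

Lemma gauge_sq W T : gauge W T * gauge W T = 1.
Proof. by rewrite -big_split big1 // => s _; apply: sgn_sq. Qed.

Definition local_chain f mu T : K := gauge (supp mu) T * f (cell_at mu T).

Lemma local_chainK f mu T :
  gauge (supp mu) T * local_chain f mu T = f (cell_at mu T).
Proof. by rewrite mulrA gauge_sq mul1r. Qed.

Lemma sgn_setD s W T : T \subset W ->
  sgn K s (W :\: T) = sgn K s W * sgn K s T.
Proof.
move=> TW; rewrite /sgn -[#|[set t in W | _]|](cardsID T) exprD.
have -> : [set t in W | (t < s)%N] :&: T = [set t in T | (t < s)%N].
  apply/setP => t; rewrite !inE; case: (boolP (t \in T)) => tT; rewrite ?andbF //.
  by rewrite (subsetP TW) // andbT.
have -> : [set t in W | (t < s)%N] :\: T = [set t in W :\: T | (t < s)%N].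
  by apply/setP => t; rewrite !inE andbA.
by rewrite mulrAC -expr2 sqrr_sign mul1r.
Qed.

(** The dictionary between the two complexes: an entry of the Koszul differential sees only cells of
    the same multidegree, namely those at [T :\ s], and up to [gauge] it is a simplicial
    coboundary. *)
Lemma chain_row_koszul i f mu T (q : kbasis e i j) :
  strand mu T -> val q = cell_at mu T ->
  (chain_row i.+1 f *m koszul_mx K e i j) 0 (enum_rank q) =
  gauge (supp mu) T * cobd (local_chain f mu) T.
Proof.
move=> FT qE; have TP : T \subset supp mu by case/andP: FT.
have mu_j : (\sum_k mu k = j)%N.
  by rewrite -(multideg_cell_at mu T) -qE (sum_multideg_kbasis (valP q)).
have cq : #|supp mu :\: T| = i by case/and3P: (valP q); rewrite qE => /eqP.
rewrite mxE (reindex (@enum_rank (kbasis e i.+1 j))) /=; last first.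
  exact/onW_bij/enum_rank_bij.
under eq_bigr => p _ do rewrite chain_rowE mxE !enum_rankK big_distrr /=.
(* The removed [s] divides the monomial of [q] and is not in its exterior part, which forces it into
   [T]: the terms with [s] outside [T] vanish. *)
rewrite (exchange_big_dep predT) //= (bigID (mem T)) /= [X in _ + X]big1 ?addr0; last first.
  move=> s sT; rewrite big1 // => p sp; case: ifP; last by rewrite mulr0.
  rewrite qE /= => /andP[/eqP pE /forallP/(_ s)]; rewrite lowerE eqxx addn1.
  have -> : s \in supp mu :\: T = false by rewrite pE setD11.
  rewrite subn0 => /eqP mus; case/negP: sT.
  have : s \notin supp mu :\: T by rewrite pE setD11.
  by rewrite !inE mus andbT negbK.
rewrite /cobd big_distrr /=; apply: eq_bigr => s sT.
have FTs := strand_sub (subsetDl T [set s]) FT.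
have Ds : supp mu :\: (T :\ s) = s |: (supp mu :\: T).
  rewrite setDDr setUC; congr (_ :|: _); apply/setIidPr.
  by rewrite sub1set (subsetP TP).
have cs : #|supp mu :\: (T :\ s)| = i.+1.
  by rewrite Ds cardsU1 !inE sT cq.
have sN : s \notin supp mu :\: T by rewrite inE sT.
(* For [s] in [T], [p0] is the only basis element that reaches [q] by removing [s]. *)
pose p0 : kbasis e i.+1 j := Sub (cell_at mu (T :\ s)) (cell_at_kbasis FTs mu_j cs).
rewrite (bigD1 p0) ?SubK /= ?Ds ?setU11 //= [X in _ + X]big1 ?addr0; last first.
  case=> -[S m] pP /andP[/= sp pp0]; case: ifP; last by rewrite mulr0.
  rewrite qE /= => /andP[/eqP pE /forallP mE]; case/negP: pp0; apply/eqP.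
  apply: val_inj; rewrite /p0 !SubK /cell_at Ds pE setD1K //=; congr (_, _).
  apply/ffunP => k; apply: val_inj; rewrite /= lowerE.
  have := eqP (mE k); rewrite lowerE pE !inE.
  by case: eqP => [->|_] /=; rewrite ?sp ?subn0 => ->; rewrite ?addn0 ?addnK.
rewrite qE /= setU1K // eqxx /=; case: ifP => [_|/negP[]]; last first.
  apply/forallP => k; rewrite !lowerE in_setU1; apply/eqP.
  case: (eqVneq k s) => [->|_]; rewrite ?addn0 //= (negbTE sN).
  by rewrite subn0 subnK //; have := subsetP TP _ sT; rewrite inE.
have <- : sgn K s (supp mu :\: T) = (-1) ^+ #|[set t in s |: supp mu :\: T | (t < s)%N]|.
  by rewrite -[RHS]/(sgn K s _) sgn_setU1 // ltnn mul1r.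
(* The Koszul sign of [s] is the product of its signs in [supp mu] and in [T]. The former is the
   factor that [gauge] gains from [T :\ s] to [T]. *)
rewrite sgn_setD // /local_chain [gauge _ T](big_setD1 s) //=.
rewrite -/(gauge _ (T :\ s)) /cell_at Ds.
set f0 := f _; set g := gauge _ _; set a := sgn _ _ _; set b := sgn _ _ _.
rewrite (_ : _ * _ * _ = (g * g) * (f0 * (a * b))); first by rewrite gauge_sq mul1r.
ring.
Qed.

(** Read through [chain_row_koszul], two successive differentials become two successive coboundaries
    in each multidegree. *)
Lemma koszul_mx_comp i : koszul_mx K e i.+1 j *m koszul_mx K e i j = 0.
Proof.
apply/row_matrixP => r; rewrite row_mul row0; set v := row r _.
have [f ->] : exists f, v = chain_row i.+2 f *m koszul_mx K e i.+1 j.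
  have [f Df] := chain_row_surj (delta_mx 0 r : 'rV[K]_#|{: kbasis e i.+2 j}|).
  by exists f; rewrite -Df -rowE.
have [g Dg] := chain_row_surj (chain_row i.+2 f *m koszul_mx K e i.+1 j).
apply/rowP => k; rewrite Dg -(enum_valK k) [RHS]mxE.
set q := enum_val k; have qP := valP q.
have FT := strand_multideg qP; have qE := esym (cell_at_multideg qP).
rewrite (chain_row_koszul _ FT qE); set mu := multideg _ in FT qE *.
set T := _ :\: _ in FT qE *.
rewrite (_ : cobd _ T = cobd (cobd (local_chain f mu)) T); first by rewrite cobd_cobd mulr0.
apply: eq_cobd => s sT; have FTs := strand_sub (subsetDl T [set s]) FT.
have TP : T \subset supp mu by case/andP: FT.
have cs : #|supp mu :\: (T :\ s)| = i.+1.
  have -> : supp mu :\: (T :\ s) = s |: (supp mu :\: T).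
    rewrite setDDr setUC; congr (_ :|: _); apply/setIidPr.
    by rewrite sub1set (subsetP TP).
  rewrite cardsU1 inE sT /=; congr _.+1.
  by case/and3P: qP; rewrite qE => /eqP.
have q1P := cell_at_kbasis FTs (sum_multideg_kbasis qP) cs.
have := chain_row_koszul f FTs (SubK _ q1P : val (Sub _ q1P : kbasis e i.+1 j) = _).
rewrite Dg chain_rowE SubK /local_chain => ->.
by rewrite mulrA gauge_sq mul1r.
Qed.

(** An exponent above one at [x] gives a cone with apex [x], exact in every degree, so truncation of
    the subtraction is harmless. Otherwise the support has [j] elements and the degree is [j - i],
    which exceeds [k]. *)
Lemma strand_exact mu (i k : nat) : (forall W, cohom_vanish K e W k) ->
  (\sum_k mu k = j)%N -> (i + k < j)%N ->
  exact_at K (strand mu) (#|supp mu| - i).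
Proof.
move=> van mu_j ikj; case: (boolP [exists x, (1 < mu x)%N]) => [/existsP[x mux]|].
  apply: (@exact_cone _ _ _ x) => T FT; have /andP[TP /standard_monP std] := FT.
  have xTP : x |: T \subset supp mu by rewrite subUset sub1set inE ltnW.
  rewrite /strand xTP; apply/standard_monP => y z.
  rewrite !inE !lower_cell_gt0 // => yS zS; apply: std; rewrite inE lower_cell_gt0 //.
    by move: yS; rewrite !inE; case: eqP => [->|]; rewrite ?mux ?orbT.
  by move: zS; rewrite !inE; case: eqP => [->|]; rewrite ?mux ?orbT.
rewrite negb_exists => /forallP small.
have c : #|supp mu| = j.
  rewrite -mu_j -sum1_card big_mkcond; apply: eq_bigr => x _ /=.
  by have := small x; rewrite inE; case: (mu x : nat) => [|[]].
apply: (@eq_exact_at _ _ (ind_complex e (supp mu))); last by apply: van; rewrite c; lia.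
move=> T; rewrite /ind_complex /strand; case: (boolP (T \subset _)) => //= TP.
have suppT : supp (cell_at mu T).2 = T.
  by apply/setP => y; rewrite inE lower_cell_gt0 // (negbTE (small y)) orbF.
by apply/independentP/standard_monP; rewrite suppT.
Qed.

Lemma local_chain_cocycle i f :
  chain_row i.+1 f *m koszul_mx K e i j = 0 ->
  forall mu T, (\sum_k mu k = j)%N -> strand mu T -> #|supp mu :\: T| = i ->
  cobd (local_chain f mu) T = 0.
Proof.
move=> cyc mu T mu_j FT cT; have qP := cell_at_kbasis FT mu_j cT.
have := chain_row_koszul f FT (SubK _ qP : val (Sub _ qP : kbasis e i j) = _).
rewrite cyc mxE => /(congr1 ( *%R (gauge (supp mu) T))).
by rewrite mulr0 mulrA gauge_sq mul1r.
Qed.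

(** Primitives are found in each multidegree separately and then glued. The cycle condition is
    written with a successor so that it is empty for [i = 0], where no differential leaves. *)
Lemma chain_row_boundary i k f : (forall W, cohom_vanish K e W k) -> (i + k < j)%N ->
  (forall mu T, (\sum_k mu k = j)%N -> strand mu T -> #|supp mu :\: T|.+1 = i ->
     cobd (local_chain f mu) T = 0) ->
  exists g, chain_row i f = chain_row i.+1 g *m koszul_mx K e i j.
Proof.
move=> van ikj cyc.
have /fin_all_exists[b bP] mu : exists b : {set 'I_n} -> K, (\sum_k mu k = j)%N -> forall T,
    strand mu T -> #|supp mu :\: T| = i -> local_chain f mu T = cobd b T.
  case: (eqVneq (\sum_k mu k)%N j) => [mu_j|/eqP//]; last by exists (fun=> 0).
  (* If [i] exceeds the size of the support, no [T] leaves an exterior part of size [i]. *)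
  case: (leqP i #|supp mu|) => [iP|Pi]; last first.
    exists (fun=> 0) => _ T _ cT.
    by have := subset_leq_card (subsetDl (supp mu) T); rewrite cT leqNgt Pi.
  have [|b bP] := strand_exact (c := local_chain f mu) van mu_j ikj.
    move=> T FT cT; have TP : T \subset supp mu by case/andP: FT.
    have := subset_leq_card TP; rewrite cT => PiP.
    by apply: cyc => //; rewrite cardsDS // cT subnSK // subKn.
  exists b => _ T FT cT; apply: bP => //.
  have TP : T \subset supp mu by case/andP: FT.
  by rewrite -cT cardsDS // subKn // subset_leq_card.
(* Each cell reads the primitive of its own multidegree, so the choices do not interfere. *)
exists (fun p => let P := supp (multideg p) in
  gauge P (P :\: p.1) * b (multideg p) (P :\: p.1)).
apply/rowP => k'; rewrite -(enum_valK k') chain_rowE.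
set q := enum_val k'; have qP := valP q.
have FT := strand_multideg qP; have qE := esym (cell_at_multideg qP).
have mu_j := sum_multideg_kbasis qP.
rewrite (chain_row_koszul _ FT qE); set mu := multideg _ in FT qE mu_j *.
set T := _ :\: _ in FT qE *; rewrite qE -local_chainK; congr (_ * _).
have cq : #|supp mu :\: T| = i by case/and3P: qP; rewrite qE => /eqP.
rewrite (bP _ mu_j _ FT cq); apply: eq_cobd => s sT.
have sub : T :\ s \subset supp mu := subset_trans (subsetDl _ _) (subsetDl _ _).
rewrite /local_chain multideg_cell_at /= setDDr setDv set0U (setIidPr sub).
by rewrite mulrA gauge_sq mul1r.
Qed.

Lemma betti_vanish i k : (forall W, cohom_vanish K e W k) -> (i + k < j)%N ->
  betti K e i j = 0%N.
Proof.
move=> van ikj; apply/eqP; rewrite subn_eq0.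
case: i ikj => [|i] ikj /=; rewrite /betti /koszul_rank.
  (* In homological degree zero everything is a cycle, so all rows of the identity matrix must be
     boundaries. *)
  rewrite subn0 -[leqLHS](mxrank1 K); apply: mxrankS; apply/row_subP => r.
  have [f ->] := chain_row_surj (row r 1%:M).
  have [|g ->] := @chain_row_boundary 0 k f van ikj; last exact: submxMl.
  by [].
rewrite -mxrank_ker; apply: mxrankS; apply/row_subP => r.
have [f Df] := chain_row_surj (row r (kermx (koszul_mx K e i j))).
have cyc : chain_row i.+1 f *m koszul_mx K e i j = 0.
  by rewrite -Df -row_mul mulmx_ker row0.
have [|g Dg] := @chain_row_boundary i.+1 k f van ikj; last by rewrite Df Dg submxMl.
move=> mu T mu_j FT [cT]; exact: local_chain_cocycle cyc _ _ mu_j FT cT.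
Qed.

(** As subtraction is truncated, a zero Betti number gives one inequality between the ranks of image
    and kernel; [koszul_mx_comp] gives the inclusion that turns it into equality. *)
Lemma betti_eq0_boundary i (v : 'rV[K]_#|{: kbasis e i.+1 j}|) :
  betti K e i.+1 j = 0%N -> v *m koszul_mx K e i j = 0 ->
  exists f, v = chain_row i.+2 f *m koszul_mx K e i.+1 j.
Proof.
move=> /eqP; rewrite subn_eq0 /= -mxrank_ker => le_rank cyc.
have ker_sub : (koszul_mx K e i.+1 j <= kermx (koszul_mx K e i j))%MS.
  by apply/sub_kermxP; apply: koszul_mx_comp.
have /eqmxP/eqmx_sym eq_ker : (koszul_mx K e i.+1 j == kermx (koszul_mx K e i j))%MS.
  by rewrite -mxrank_leqif_eq // eqn_leq mxrankS.
have /submxP[w ->] : (v <= koszul_mx K e i.+1 j)%MS.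
  by rewrite -eq_ker; apply/sub_kermxP.
by have [f ->] := chain_row_surj w; exists f.
Qed.

End KoszulStrand.

(** * The cross-polytope cycle of an induced matching *)

Section InducedMatching.
Variables (K : fieldType) (n r : nat) (x y : 'I_r -> 'I_n).
Implicit Types (i k : 'I_r) (A : {set 'I_r}).

Definition pick_end A k : 'I_n := if k \in A then y k else x k.

(** With one end picked from each edge, these are the facets of the boundary of a cross-polytope;
    [A] records where the end [y] is picked. *)
Definition transversal A : {set 'I_n} := [set pick_end A k | k in 'I_r].

Hypothesis pick_inj : forall A, injective (pick_end A).
Hypothesis blocks : forall i k, i != k ->
  [/\ (y i < x k)%N = (x i < x k)%N, (x i < y k)%N = (x i < x k)%N
    & (y i < y k)%N = (x i < x k)%N].

(** By [blocks] the edges do not interleave in the vertex order, so the number of picked vertices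
    below the [k]-th one is the same for all [A]. *)
Lemma sgn_transversal A k :
  sgn K (pick_end A k) (transversal A) = (-1) ^+ #|[set i | (x i < x k)%N]|.
Proof.
rewrite /sgn -(card_imset _ (pick_inj (A := A))); congr (_ ^+ #|pred_of_set _|).
have lt_pick i : (pick_end A i < pick_end A k)%N = (x i < x k)%N.
  case: (eqVneq i k) => [->|/blocks[yx xy yy]]; first by rewrite !ltnn.
  by rewrite /pick_end; do 2!case: ifP.
apply/setP => t; rewrite inE; apply/andP/imsetP => [[/imsetP[i _ ->]]|[i]].
  by rewrite lt_pick => ik; exists i; rewrite ?inE.
by rewrite inE => ik ->; rewrite lt_pick ik imset_f.
Qed.

(* Toggling [k] in [A] changes the sign but not [transversal A] minus its
   [k]-th element, so the signed transversals form a cycle. *)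
Lemma sum_cobd_transversal (b : {set 'I_n} -> K) :
  \sum_(A : {set 'I_r}) (-1) ^+ #|A| * cobd b (transversal A) = 0.
Proof.
pose G k A := (-1) ^+ #|A| * b (transversal A :\ pick_end A k).
transitivity (\sum_k (-1) ^+ #|[set i | (x i < x k)%N]| * \sum_(A : {set 'I_r}) G k A).
  under [RHS]eq_bigr do rewrite big_distrr /=.
  rewrite exchange_big; apply: eq_bigr => A _; rewrite /cobd big_imset /=; last first.
    by move=> i k _ _; apply: pick_inj.
  rewrite big_distrr /=; apply: eq_bigr => k _.
  by rewrite sgn_transversal /G mulrCA.
rewrite big1 // => k _; rewrite (bigID (fun A : {set 'I_r} => k \in A)) /=.
rewrite (reindex_onto (fun A : {set 'I_r} => k |: A) (fun A => A :\ k)) /=; last exact: setD1K.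
rewrite (eq_bigl (fun A : {set 'I_r} => k \notin A)); last first.
  move=> A; rewrite setU11 /=; apply/eqP/idP => [<-|/setU1K//].
  by rewrite setD11.
rewrite -big_split big1 ?mulr0 //= => A kA; rewrite /G cardsU1 kA exprS mulN1r.
rewrite mulNr; apply/eqP; rewrite addrC subr_eq0; apply/eqP.
have pickU i : i != k -> pick_end (k |: A) i = pick_end A i.
  by move=> ik; rewrite /pick_end !inE (negbTE ik).
have rm B : transversal B :\ pick_end B k = [set pick_end B i | i in [set~ k]].
  apply/setP => t; rewrite in_setD1; apply/andP/imsetP => [[tk /imsetP[i _ ti]]|[i]].
    by exists i; rewrite // !inE; apply: contraNneq tk => <-; rewrite ti.
  by rewrite !inE => ik ->; rewrite imset_f // (inj_eq (pick_inj (A := B))).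
congr (_ * b _); rewrite !rm; apply: eq_in_imset => i; rewrite !inE => ik.
by rewrite pickU.
Qed.

End InducedMatching.

(** * A nonzero Betti number from an induced matching *)

Section MatchingBetti.
Variables (K : fieldType) (n r : nat) (e : rel 'I_n) (x y : 'I_r.+1 -> 'I_n).
Hypothesis e_simple : simple_graph e.
Hypothesis edge_xy : forall i, e (x i) (y i).
Hypothesis induced : forall i k, i != k ->
  [/\ ~~ e (x i) (x k), ~~ e (x i) (y k) & ~~ e (y i) (y k)].
Hypothesis blocks : forall i k, i != k ->
  [/\ (y i < x k)%N = (x i < x k)%N, (x i < y k)%N = (x i < x k)%N
    & (y i < y k)%N = (x i < x k)%N].
Local Notation pick := (pick_end x y).
Local Notation trans := (transversal x y).

Let x_neq_y i k : x i != y k.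
Proof.
have [sym irr] := e_simple; case: (eqVneq i k) => [->|ik].
  by apply: contraTneq (edge_xy k) => ->.
have [nxx _ _] := induced ik.
by apply: contraNneq nxx => ->; rewrite sym edge_xy.
Qed.

Let pick_inj A : injective (pick A).
Proof.
move=> i k; apply: contra_eq => ik.
have [nxx nxy nyy] := induced ik; rewrite eq_sym in ik.
rewrite /pick_end; case: ifP; case: ifP => _ _; rewrite ?x_neq_y //.
- by have [_ kxy _] := induced ik; apply: contraNneq kxy => ->.
- by rewrite eq_sym x_neq_y.
- by apply: contraNneq nxy => ->.
Qed.

Let pick_nonadjacent A i k : ~~ e (pick A i) (pick A k).
Proof.
have [sym irr] := e_simple; case: (eqVneq i k) => [->|ik]; first exact: irr.
have [nxx nxy nyy] := induced ik; rewrite eq_sym in ik.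
have [_ kxy _] := induced ik.
by rewrite /pick_end; case: ifP; case: ifP => // _ _; rewrite sym.
Qed.

Let transC A : [disjoint trans A & trans (~: A)].
Proof.
apply/pred0P => t; apply/negbTE/negP => /andP[/= /imsetP[i _ ->] /imsetP[k _]].
apply/eqP; case: (eqVneq i k) => [->|ik].
  by rewrite /pick_end inE; case: ifP => _; rewrite ?x_neq_y // eq_sym x_neq_y.
have [nxx nxy nyy] := induced ik; rewrite eq_sym in ik.
have [_ kxy _] := induced ik.
rewrite /pick_end; case: ifP; case: ifP => _ _; rewrite ?x_neq_y //.
- by apply: contraNneq kxy => ->.
- by rewrite eq_sym x_neq_y.
- by apply: contraNneq nxy => ->.
Qed.

Let j := r.+1.*2.
Let W : {set 'I_n} := trans set0 :|: trans setT.
Let mu : {ffun 'I_n -> 'I_j.+1} := [ffun k => inord (k \in W)].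

Let muE k : mu k = (k \in W) :> nat.
Proof. by rewrite ffunE inordK //; case: (_ \in _). Qed.

Let supp_mu : supp mu = W.
Proof. by apply/setP => k; rewrite inE muE; case: (_ \in _). Qed.

Let card_trans A : #|trans A| = r.+1.
Proof. by rewrite card_imset ?card_ord. Qed.

Let WE A : W = trans A :|: trans (~: A).
Proof.
apply/setP => t; rewrite !inE; apply/orP/orP; case=> /imsetP[k _ ->].
all: rewrite /pick_end ?inE.
- case: (boolP (k \in A)) => kA; [right|left]; apply/imsetP; exists k => //;
  by rewrite /pick_end ?inE ?kA ?(negbTE kA).
- case: (boolP (k \in A)) => kA; [left|right]; apply/imsetP; exists k => //;
  by rewrite /pick_end ?inE ?kA ?(negbTE kA).
- case: ifP => kA; [right|left]; apply/imsetP; exists k => //; by rewrite /pick_end ?inE.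
- case: ifP => kA; [right|left]; apply/imsetP; exists k => //; by rewrite /pick_end ?inE.
Qed.

Let card_W : #|W| = j.
Proof.
by rewrite cardsU disjoint_setI0 ?cards0 ?subn0 ?card_trans ?addnn // -setC0 transC.
Qed.

Let sum_mu : (\sum_k mu k)%N = j.
Proof.
rewrite -[RHS]card_W -sum1_card [RHS]big_mkcond /=; apply: eq_bigr => k _.
by rewrite muE; case: (_ \in _).
Qed.

Let card_D A : #|supp mu :\: trans A| = r.+1.
Proof.
rewrite supp_mu (WE A) setDUl setDv set0U.
have -> : trans (~: A) :\: trans A = trans (~: A).
  by apply/setDidPl; rewrite disjoint_sym transC.
exact: card_trans.
Qed.

Let strandP (T : {set 'I_n}) : T \subset W -> strand e mu T = independent e T.
Proof.
move=> TW; rewrite /strand supp_mu TW /=.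
have suppT : supp (cell_at mu T).2 = T.
  apply/setP => z; rewrite inE lower_cell_gt0 ?supp_mu // muE.
  by case: (z \in W); rewrite orbF.
by apply/standard_monP/independentP; rewrite suppT.
Qed.

Let trans_W A : trans A \subset W.
Proof. by rewrite (WE A) subsetUl. Qed.

Let strand_trans A : strand e mu (trans A).
Proof.
rewrite strandP //; apply/independentP => _ _ /imsetP[i _ ->] /imsetP[k _ ->].
exact: pick_nonadjacent.
Qed.

(** The indicator [f0] of the facet [trans set0] is a cocycle, since any further vertex of [W] is
    some [y i], adjacent to [x i]. It pairs to a sign with the cross-polytope cycle, whereas
    coboundaries pair to zero. *)
Lemma betti_induced_matchingS : betti K e r.+1 r.+1.*2 != 0%N.
Proof.
apply/eqP => betti0.
pose f0 p : K := (p == cell_at mu (trans set0))%:R.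
have cyc : chain_row e r.+1 f0 *m koszul_mx K e r j = 0.
  apply/rowP => k; rewrite -(enum_valK k) [RHS]mxE.
  set q := enum_val k; have qP := valP q.
  have FT := strand_multideg qP; have qE := esym (cell_at_multideg qP).
  rewrite (chain_row_koszul _ FT qE) /cobd big1 ?mulr0 // => s sT.
  rewrite /local_chain /f0; case: eqP => [eq_cell|]; last by rewrite !mulr0.
  have eq_mu : multideg (val q) = mu.
    by have := congr1 (@multideg _ _) eq_cell; rewrite !multideg_cell_at.
  rewrite eq_mu in FT sT eq_cell; set T := _ :\: _ in FT sT eq_cell.
  have TP : T \subset supp mu by case/andP: FT.
  have eqT : T :\ s = trans set0.
    have := congr1 (fun p : _ * _ => supp mu :\: p.1) eq_cell.
    rewrite /= !setDDr !setDv !set0U !(setIidPr _) ?supp_mu //.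
    by apply: subset_trans (subsetDl _ _) _; rewrite -supp_mu.
  have := FT; rewrite strandP -?supp_mu // => /independentP ind.
  have : s \in W by rewrite -supp_mu (subsetP TP).
  have sN : s \notin trans set0 by rewrite -eqT setD11.
  rewrite inE (negbTE sN) /= => /imsetP[i _]; rewrite /pick_end inE => si.
  have xT : x i \in T.
    have : x i \in trans set0 by apply/imsetP; exists i; rewrite // /pick_end inE.
    by rewrite -eqT inE => /andP[].
  by have := ind _ _ xT sT; rewrite si edge_xy.
have [f Df] := betti_eq0_boundary betti0 cyc.
have cobdE A : cobd (local_chain f mu) (trans A) =
    gauge K (supp mu) (trans A) * f0 (cell_at mu (trans A)).
  have qP := cell_at_kbasis (strand_trans A) sum_mu (card_D A).
  have qE : val (Sub _ qP : kbasis e r.+1 j) = cell_at mu (trans A) by rewrite SubK.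
  have := chain_row_koszul f (strand_trans A) qE.
  by rewrite -Df chain_rowE SubK => ->; rewrite mulrA gauge_sq mul1r.
(* In the pairing only [A = set0] survives, as every other transversal contains some [y k]. *)
have := sum_cobd_transversal pick_inj blocks (local_chain f mu).
rewrite (bigD1 set0) //= big1 => [|A A0].
  rewrite cards0 mul1r addr0 cobdE /f0 eqxx mulr1 => g0.
  by have := gauge_sq K (supp mu) (trans set0); rewrite g0 mul0r => /esym/eqP; rewrite oner_eq0.
rewrite cobdE /f0; case: eqP => [eq_cell|]; last by rewrite !mulr0.
have := congr1 (fun p : _ * _ => supp mu :\: p.1) eq_cell.
rewrite /= !setDDr !setDv !set0U !(setIidPr _) ?supp_mu // => eqA.
have [k kA] := set0Pn _ A0.
have : y k \in trans set0 by rewrite -eqA; apply/imsetP; exists k; rewrite // /pick_end kA.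
by case/imsetP => i _ /eqP; rewrite /pick_end inE eq_sym (negbTE (x_neq_y _ _)).
Qed.

End MatchingBetti.

Lemma betti_induced_matching (K : fieldType) (n r : nat) (e : rel 'I_n)
    (x y : 'I_r -> 'I_n) :
  simple_graph e -> (0 < r)%N -> (forall i, e (x i) (y i)) ->
  (forall i k, i != k ->
     [/\ ~~ e (x i) (x k), ~~ e (x i) (y k) & ~~ e (y i) (y k)]) ->
  (forall i k, i != k ->
     [/\ (y i < x k)%N = (x i < x k)%N, (x i < y k)%N = (x i < x k)%N
       & (y i < y k)%N = (x i < x k)%N]) ->
  betti K e r r.*2 != 0%N.
Proof. by case: r x y => // r x y *; apply: (@betti_induced_matchingS K n r e x y). Qed.

(** * Greedy bounds on the v-number, and the upper bounds for connected graphs *)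

Section UpperBounds.
Variables (n : nat) (e : rel 'I_n).
Hypothesis e_simple : simple_graph e.
Implicit Types (x y : 'I_n) (A W : {set 'I_n}).

(** The v-number condition relative to the induced subgraph on [W], so that closed neighbourhoods
    can be removed repeatedly. *)
Definition v_witness W A : Prop :=
  [/\ A \subset W, independent e A
    & {in W &, forall x y, e x y -> (x \in nbhd e A) || (y \in nbhd e A)}].

Lemma nbhdU1 x A : nbhd e (x |: A) = [set y | e x y] :|: nbhd e A.
Proof.
apply/setP => y; rewrite !inE; apply/exists_inP/orP => [[z]|[exy|/exists_inP[z zA ezy]]].
- rewrite !inE => /predU1P[->|zA] ezy; [by left | right].
  by apply/exists_inP; exists z.
- by exists x; rewrite ?setU11.
- by exists z; rewrite ?inE ?zA ?orbT.
Qed.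

(** An edge of [W] not covered by the neighbours of [x] lies entirely in [W :\: closed_nbhd x],
    where [A] takes care of it. *)
Lemma v_witness_add W x A : x \in W ->
  v_witness (W :\: closed_nbhd e x) A -> v_witness W (x |: A).
Proof.
have [sym irr] := e_simple => xW [AW indA covA]; split.
- by rewrite subUset sub1set xW (subset_trans AW) ?subsetDl.
- rewrite independentU1 // indA disjoint_sym /=.
  move: AW; rewrite subsetD => /andP[_]; apply: disjointWr.
  exact: subsetUr.
move=> y z yW zW eyz; rewrite nbhdU1 !inE.
case: (boolP (e x y)) => //= exy; case: (boolP (e x z)) => [//|exz] /=.
  by rewrite orbT.
have := covA y z; rewrite !inE yW zW eyz (negbTE exy) (negbTE exz) !orbF !andbT; apply=> //.
  by apply: contraNneq exz => <-.
by apply: contraNneq exy => <-; rewrite sym.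
Qed.

Lemma v_witness_half W : exists A, v_witness W A /\ (#|A|.*2 <= #|W|)%N.
Proof.
have [m] := ubnP #|W|; elim: m => // m IHm in W *; rewrite ltnS => Wm.
case: (boolP [forall x in W, forall y in W, ~~ e x y]) => [edgeless|].
  exists set0; rewrite cards0; split=> //; split.
  - exact: sub0set.
  - by apply/independentP => x y; rewrite inE.
  - by move=> x y xW yW exy; have := forall_inP (forall_inP edgeless x xW) y yW; rewrite exy.
case/forall_inPn => x xW /forall_inPn[y yW]; rewrite negbK => exy.
have xy : x != y by apply: contraTneq exy => ->; have [_ ->] := e_simple.
have := @subset_card_closed_nbhd _ e W x [set x; y].
rewrite cards2 xy !subUset !sub1set xW yW !inE exy eqxx orbT => /(_ isT isT) /= c2.
have [|A [witA cA]] := IHm (W :\: closed_nbhd e x).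
  by rewrite (leq_trans _ Wm) // (leq_trans _ c2) // addn2 ltnW.
exists (x |: A); split; first exact: v_witness_add.
rewrite (leq_trans _ c2) // cardsU1 doubleD addnC leq_add //.
by case: (x \in A).
Qed.

(** Strictness comes from the first greedy step, which spends one vertex and removes three. *)
Lemma v_witness_degree2 x y z : y != z -> e x y -> e x z ->
  exists A, v_witness setT A /\ (#|A|.*2 < n)%N.
Proof.
move=> yz exy exz; have [_ irr] := e_simple.
have xy : x != y by apply: contraTneq exy => ->.
have xz : x != z by apply: contraTneq exz => ->.
have := @subset_card_closed_nbhd _ e setT x (x |: [set y; z]).
rewrite subsetT !subUset !sub1set !inE exy exz eqxx !orbT => /(_ isT isT).
rewrite cardsU1 !inE negb_or xy xz cards2 yz cardsT card_ord /= => c3.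
have [A [witA cA]] := v_witness_half (setT :\: closed_nbhd e x).
exists (x |: A); split; first by apply: v_witness_add; rewrite ?inE.
rewrite (leq_trans _ c3) // cardsU1 doubleD addnC -addnS leq_add //.
by case: (x \in A).
Qed.

Lemma v_witness_bound A v : v_witness setT A -> is_vnumber e v -> (v <= #|A|)%N.
Proof.
move=> [_ indA covA] [_]; apply=> //; apply/forallP => x; apply/forallP => y.
by apply/implyP; apply: covA; rewrite inE.
Qed.

Hypotheses (e_conn : connected_graph e) (n_gt2 : (2 < n)%N).

(** Otherwise [x0], together with its neighbour if it has one, is closed under adjacency, so the
    connected graph would have at most two vertices. *)
Lemma connected_degree2 : exists x y z, [/\ y != z, e x y & e x z].
Proof.
have [sym irr] := e_simple; pose x0 : 'I_n := Ordinal (ltnW (ltnW n_gt2)).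
case: (boolP [exists x, exists y, exists z, [&& y != z, e x y & e x z]]).
  by case/existsP => x /existsP[y /existsP[z /and3P[]]]; exists x, y, z.
move=> no_deg2; exfalso.
have uniq_nbr x y z : e x y -> e x z -> y = z.
  move=> exy exz; apply/eqP; apply: contraNT no_deg2 => yz.
  by apply/existsP; exists x; apply/existsP; exists y; apply/existsP; exists z; apply/and3P.
have closedP (a : {set 'I_n}) x : x \in a ->
    (forall u w, e u w -> u \in a -> w \in a) -> (n <= #|a|)%N.
  move=> xa stable; rewrite -[leqLHS]card_ord; apply: subset_leq_card.
  apply/subsetP => z _; have sym_e : connect_sym e.
    by apply: sym_connect_sym => u w; rewrite sym.
  by rewrite -(closed_connect (intro_closed sym_e stable) (e_conn x z)).
case: (pickP (e x0)) => [y exy|none].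
  have := @closedP [set x0; y] x0; rewrite !inE eqxx => /(_ isT).
  rewrite cards2; suff stable u w : e u w -> u \in [set x0; y] -> w \in [set x0; y].
    by move/(_ stable); case: eqP => _ /(leq_trans n_gt2).
  rewrite !inE => euw /orP[]/eqP uE; rewrite uE in euw.
    by rewrite (uniq_nbr _ _ _ euw exy) eqxx orbT.
  by rewrite sym in exy; rewrite (uniq_nbr _ _ _ euw exy) eqxx.
have := @closedP [set x0] x0; rewrite !inE eqxx cards1 => /(_ isT).
suff stable u w : e u w -> u \in [set x0] -> w \in [set x0].
  by move/(_ stable)/(leq_trans n_gt2).
by rewrite !inE => euw /eqP uE; rewrite uE none in euw.
Qed.

End UpperBounds.

Lemma RV_sub_setB (K : fieldType) (n r v : nat) :
  (3 <= n)%N -> RV K n r v -> setB n r v.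
Proof.
move=> n_gt2 [e [e_simple conn [[i [j [bij jE]]] reg_le] vnum]].
have [x [y [z [yz exy exz]]]] := connected_degree2 e_simple conn n_gt2.
split.
(* A single edge is an induced matching of size one, which gives regularity at least one. *)
- suff /reg_le : betti K e 1 2 != 0%N by [].
  apply: (@betti_induced_matching K n 1 e (fun=> x) (fun=> y)) => //;
  by move=> a b; rewrite !ord1.
(* [k] is the largest integer below [n / 2], positive because [n] is at least three. *)
- have [k kP] : exists k, (0 < k)%N /\ (k.*2 < n <= k.*2.+2)%N.
    by exists n.-1./2; lia.
  rewrite ltnNge; apply: contraNN bij => nr; apply/eqP.
  apply: (@betti_vanish _ _ _ _ _ k); last by lia.
  by move=> W; apply: (cohom_vanish_degree2 e_simple _ _ yz exy exz); lia.
- have [[A [_ covA cA]] _] := vnum; rewrite -cA card_gt0.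
  apply: contraTneq covA => ->; apply/forallPn; exists x; apply/forallPn; exists y.
  by rewrite exy /= !inE negb_or; apply/andP; split; apply/exists_inPn => w; rewrite inE.
- have [A [witA cA]] := v_witness_degree2 e_simple yz exy exz.
  by have := v_witness_bound witA vnum; lia.
Qed.

(** * Cliques of hubs with legs: regularity and v-number *)

Section Construction.
Local Open Scope nat_scope.
Variables (K : fieldType) (n r m a : nat) (near : nat -> nat -> bool).

(* Leg [i] consists of a foot [2i] and a tip [2i+1]; the vertices from [2r] on are
   the hubs, and [near c i] says that hub number [c] is joined to foot [i]. *)
Definition arc (p q : nat) : bool :=
  if p < r.*2 then [&& q < r.*2, p./2 == q./2 & p != q]
  else if q < r.*2 then ~~ odd q && near (p - r.*2) q./2 else p != q.

Definition legged_clique : rel 'I_n := fun x y => arc x y || arc y x.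

Hypotheses (nE : n = r.*2 + m) (r_gt0 : 0 < r) (m_gt0 : 0 < m).
Hypothesis near_hub : forall i, i < r -> exists2 c, c < m & near c i.
Hypothesis near_leg : forall c, c < m -> exists2 i, i < r & near c i.

Local Notation e := legged_clique.
Implicit Types (i k : 'I_r) (x y z c : 'I_n) (A W : {set 'I_n}).

Let foot_lt i : i.*2 < n. Proof. by rewrite nE; have := ltn_ord i; lia. Qed.
Let tip_lt i : i.*2.+1 < n. Proof. by rewrite nE; have := ltn_ord i; lia. Qed.
Let hub_lt d : d < m -> r.*2 + d < n. Proof. by rewrite nE; lia. Qed.
Let foot i : 'I_n := Ordinal (foot_lt i).
Let tip i : 'I_n := Ordinal (tip_lt i).
Let hub d (dm : d < m) : 'I_n := Ordinal (hub_lt dm).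
Let is_hub x : bool := r.*2 <= x.

Let vertexP x : [\/ exists i, x = foot i, exists i, x = tip i | is_hub x].
Proof.
rewrite /is_hub; case: (leqP r.*2 x) => xr; first by constructor 3.
have hr : x./2 < r by lia.
case: (boolP (odd x)) => ox; [constructor 2|constructor 1];
  by exists (Ordinal hr); apply: val_inj => /=; lia.
Qed.

Lemma legged_clique_simple : simple_graph e.
Proof.
split=> [x y|x]; first by rewrite /e orbC.
by rewrite /e /arc orbb; case: ifP => xr; rewrite !eqxx ?xr /= ?andbF.
Qed.

Let e_simple := legged_clique_simple.

Let e_hub_hub c z : is_hub c -> is_hub z -> e c z = (c != z).
Proof.
rewrite /is_hub /e /arc => hc hz.
by rewrite !ltnNge hc hz /= [in X in _ || X]eq_sym orbb val_eqE.
Qed.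

Let e_hub_foot c i : is_hub c -> e c (foot i) = near (c - r.*2) i.
Proof.
rewrite /is_hub /e /arc => hc; have := ltn_ord i => ir.
have -> : (c < r.*2) = false by lia.
have -> : (foot i < r.*2) = true by rewrite /=; lia.
by rewrite /= odd_double doubleK orbF.
Qed.

Let e_hub_tip c i : is_hub c -> e c (tip i) = false.
Proof.
rewrite /is_hub /e /arc => hc; have := ltn_ord i => ir.
have -> : (c < r.*2) = false by lia.
have -> : (tip i < r.*2) = true by rewrite /=; lia.
by rewrite /= odd_double.
Qed.

Let e_leg x y : x < r.*2 -> y < r.*2 -> e x y = (x./2 == y./2) && (x != y).
Proof.
rewrite /e /arc => -> -> /=.
by rewrite [in X in _ || X]eq_sym [in X in _ || _ && X]eq_sym orbb.
Qed.

Let leg_lt i : (foot i < r.*2) * (tip i < r.*2).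
Proof. by have := ltn_ord i; split=> /=; lia. Qed.

Let e_foot_foot i k : e (foot i) (foot k) = false.
Proof.
rewrite e_leg ?leg_lt //= !doubleK -val_eqE /=.
by case: eqP => //= ->; rewrite eqxx.
Qed.

Let e_tip_tip i k : e (tip i) (tip k) = false.
Proof.
rewrite e_leg ?leg_lt // -val_eqE /= !uphalf_double.
by case: eqP => //= ->; rewrite eqxx.
Qed.

Let e_foot_tip i k : e (foot i) (tip k) = (i == k).
Proof.
rewrite e_leg ?leg_lt // -!val_eqE /= doubleK uphalf_double.
by case: eqP => //= ->; apply/eqP; lia.
Qed.

Let e_sym x y : e x y = e y x. Proof. by have [-> _] := e_simple. Qed.

Let not_hub i : (is_hub (foot i) = false) * (is_hub (tip i) = false).
Proof. by have := ltn_ord i; rewrite /is_hub /=; split; lia. Qed.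

Lemma legged_clique_connected : connected_graph e.
Proof.
pose h := hub m_gt0; have h_hub : is_hub h by rewrite /is_hub /= addn0.
have to_hub x : connect e x h.
  have hub_h c : is_hub c -> connect e c h.
    move=> hc; have [->|ch] := eqVneq c h; first exact: connect0.
    by apply: connect1; rewrite e_hub_hub.
  have foot_h i : connect e (foot i) h.
    have [d dm nd] := near_hub (ltn_ord i).
    have hd : is_hub (hub dm) by rewrite /is_hub /= leq_addr.
    apply: connect_trans (hub_h _ hd); apply: connect1.
    by rewrite e_sym e_hub_foot //= addKn.
  case: (vertexP x) => [[i ->]|[i ->]|/hub_h//]; first exact: foot_h.
  by apply: connect_trans (foot_h i); apply: connect1; rewrite e_sym e_foot_tip.
have e_csym : connect_sym e by apply: sym_connect_sym; apply: e_sym.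
by move=> x y; apply: connect_trans (to_hub x) _; rewrite e_csym.
Qed.

Let feet W : {set 'I_r} := [set i | foot i \in W].

(** Without hubs the only edges join a foot to its tip. Branching on a foot lowers the number of
    feet in both the deletion and the link, and without feet there is no edge. *)
Let vanish_no_hub W d : {in W, forall x, ~~ is_hub x} -> #|feet W| <= d ->
  cohom_vanish K e W d.
Proof.
have edgeless (U : {set 'I_n}) : {in U, forall x, ~~ is_hub x} -> feet U = set0 -> cohom_vanish K e U 0.
  move=> no_hub U0; apply: cohom_vanish_edgeless => x y xU yU.
  have isTip z : z \in U -> exists i, z = tip i.
    move=> zU; case: (vertexP z) => [[i zE]|//|hz]; last by have := no_hub z zU; rewrite hz.
    by have := in_set0 i; rewrite -U0 inE -zE zU.
  by have [[i ->] [k ->]] := (isTip x xU, isTip y yU); rewrite e_tip_tip.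
elim: d W => [|d IHd] W no_hub cW.
  by apply: edgeless => //; apply/eqP; rewrite -cards_eq0 -leqn0.
have [W0|[i]] := set_0Vmem (feet W).
  by move=> t dt; apply: edgeless => //; apply: leq_trans dt.
rewrite inE => iW.
have feetD (U : {set 'I_n}) : U \subset W -> foot i \notin U -> #|feet U| <= d.
  move=> UW iU; rewrite -ltnS (leq_trans _ cW) //; apply: proper_card.
  apply/properP; split; first by apply/subsetP => k; rewrite !inE => /(subsetP UW).
  by exists i; rewrite !inE.
apply: (cohom_vanish_vertex e_simple iW).
  move=> t dt; apply: IHd (ltnW dt).
    by move=> x; rewrite inE => /andP[_ /no_hub].
  by apply: feetD; rewrite ?subsetDl ?setD11.
apply: IHd; first by move=> x; rewrite inE => /andP[_ /no_hub].
by apply: feetD; rewrite ?subsetDl // !inE eqxx.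
Qed.

(** Hubs are eliminated one by one. The link of a hub contains no hub, and it misses the foot
    supplied by [near_leg], so at most [r - 1] feet remain. *)
Lemma legged_clique_vanish W : cohom_vanish K e W r.
Proof.
have [d] := ubnP #|W|; elim: d => // d IHd in W *; rewrite ltnS => Wd.
case: (boolP [exists c in W, is_hub c]) => [/exists_inP[c cW hc]|]; last first.
  rewrite negb_exists_in => /forall_inP no_hub; apply: vanish_no_hub => //.
  by rewrite -[leqRHS](card_ord r) max_card.
have cm : c - r.*2 < m.
  by have := ltn_ord c; move: hc; rewrite /is_hub [X in _ < X -> _]nE; lia.
have [i ir ni] := near_leg cm.
rewrite -(prednK r_gt0); apply: (cohom_vanish_vertex e_simple cW).
  rewrite prednK //; apply: IHd; rewrite (leq_trans _ Wd) //.
  by rewrite [in leqRHS](cardsD1 c) cW.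
apply: vanish_no_hub => [x|].
  rewrite !inE negb_or => /andP[/andP[xc ncx] _]; apply: contra ncx => hx.
  by rewrite e_hub_hub // eq_sym.
rewrite -ltnS prednK // -[leqRHS]card_ord -cardsT; apply: proper_card.
apply/properP; split; first exact: subsetT.
by exists (Ordinal ir); rewrite ?inE //= e_hub_foot // ni orbT.
Qed.

(** The lower bound uses the foot-tip edges; numbering the ends of leg [i] by [2i] and [2i+1] makes
    consecutive blocks of them. *)
Lemma legged_clique_reg : is_reg K e r.
Proof.
split; last first.
  move=> i j; apply: contraNT; rewrite -ltnNge => ltj; apply/eqP.
  by apply: betti_vanish ltj; apply: legged_clique_vanish.
exists r, r.*2; split; last by rewrite addnn.
apply: (@betti_induced_matching K n r e foot tip) => // i.
- by rewrite e_foot_tip.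
- by move=> k ik; rewrite e_foot_foot e_tip_tip e_foot_tip.
- by move=> k; rewrite -val_eqE /= => ik; split; lia.
Qed.

Hypotheses (a_gt0 : 0 < a) (a_le_r : a <= r).
Hypothesis near0 : forall i : nat, i < r -> near 0 i = (i < a).
Hypothesis near_card : forall c : nat, c < m -> #|[set i : 'I_r | near c i]| <= a.

Lemma legged_clique_vnumber : is_vnumber e (r - a).+1.
Proof.
pose h := hub m_gt0; have h_hub : is_hub h by rewrite /is_hub /= addn0.
have tip_inj : injective tip by move=> i k /(congr1 val) /= [] /double_inj/val_inj.
split.
  (* Hub 0 dominates the other hubs and the first [a] feet; the tips in [B] dominate the remaining
     feet. *)
  pose B := tip @: [set i : 'I_r | a <= i].
  have hB : h \notin B.
    by apply/negP => /imsetP[i _ hi]; have := not_hub i; rewrite -hi h_hub => -[].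
  have ANi i : foot i \in nbhd e (h |: B).
    rewrite inE; apply/exists_inP; case: (ltnP i a) => ia.
      by exists h; rewrite ?setU11 // e_hub_foot //= addn0 subnn near0.
    exists (tip i); last by rewrite e_sym e_foot_tip.
    by rewrite inE imset_f ?inE ?orbT.
  have ANc c : is_hub c -> c != h -> c \in nbhd e (h |: B).
    move=> hc ch; rewrite inE; apply/exists_inP.
    by exists h; rewrite ?setU11 // e_hub_hub // eq_sym.
  exists (h |: B); split.
  - rewrite independentU1 //; apply/andP; split.
      apply/independentP => _ _ /imsetP[i _ ->] /imsetP[k _ ->].
      by rewrite e_tip_tip.
    rewrite disjoint_sym; apply/pred0P => x; apply/negbTE/negP.
    by case/andP=> /= /imsetP[i _ ->]; rewrite inE e_hub_tip.
  - apply/forallP => x; apply/forallP => y; apply/implyP => exy.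
    case: (vertexP x) exy => [[i ->]|[i ->]|hx]; first by rewrite ANi.
      case: (vertexP y) => [[k ->]|[k ->]|hy]; first by rewrite ANi orbT.
        by rewrite e_tip_tip.
      by rewrite e_sym e_hub_tip.
    case: (eqVneq x h) => [->|xh]; last by rewrite ANc.
    case: (vertexP y) => [[k ->]|[k ->]|hy]; first by rewrite ANi orbT.
      by rewrite e_hub_tip.
    by rewrite e_hub_hub // eq_sym => yh; rewrite (ANc y) ?orbT.
  - rewrite cardsU1 hB card_imset // add1n; congr _.+1.
    have -> : [set i : 'I_r | a <= i] = ~: [set i : 'I_r | i < a].
      by apply/setP => i; rewrite !inE leqNgt.
    rewrite cardsCs setCK card_ord; congr (_ - _).
    have widen_inj : injective (widen_ord a_le_r) by move=> i k [] ik; apply: val_inj.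
    rewrite -[RHS]card_ord -(card_imset _ widen_inj); apply: eq_card => i.
    rewrite !inE; apply/idP/imsetP => [ia|[k _ ->]]; last exact: (ltn_ord k).
    by exists (Ordinal ia) => //; apply: val_inj.
move=> A /independentP indA covA.
(* [D] collects the legs that [A] avoids, whose foot-tip edges can be covered only through a hub in
   [A]. The other legs inject into [A] by [f]. *)
pose D := [set i | (foot i \notin A) && (tip i \notin A)].
pose f i := if foot i \in A then foot i else tip i.
have f_half i : (f i)./2 = i by rewrite /f; case: ifP => _ /=; rewrite ?doubleK ?uphalf_double.
have f_inj : injective f by move=> i k eqf; apply: val_inj; rewrite /= -(f_half i) eqf f_half.
have fA i : i \notin D -> f i \in A.
  by rewrite inE negb_and !negbK /f; case: ifP => //= _.
have f_hub i : is_hub (f i) = false by rewrite /f; case: ifP => _; rewrite not_hub.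
have cf : #|(f @: (~: D))| = r - #|D| by rewrite card_imset // cardsCs setCK card_ord.
have DP i : i \in D -> exists c, [/\ c \in A, is_hub c & near (c - r.*2) i].
  rewrite inE => /andP[nf nt].
  have /implyP := forallP (forallP covA (foot i)) (tip i); rewrite e_foot_tip eqxx => /(_ isT).
  rewrite !inE => /orP[] /exists_inP[z zA].
    case: (vertexP z) => [[k ->]|[k zE]|hz]; first by rewrite e_foot_foot.
      by rewrite zE e_sym e_foot_tip => /eqP ik; rewrite ik -zE zA in nt.
    by rewrite e_hub_foot // => nz; exists z.
  case: (vertexP z) => [[k zE]|[k ->]|hz]; last by rewrite e_hub_tip.
    by rewrite zE e_foot_tip => /eqP ki; rewrite -ki -zE zA in nf.
  by rewrite e_tip_tip.
have fD : (f @: (~: D)) \subset A.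
  by apply/subsetP => _ /imsetP[i iD ->]; apply: fA; rewrite inE in iD.
(* If no leg is avoided, [A] has at least [r] vertices, which suffices as [a] is positive. *)
have [D0|[i iD]] := set_0Vmem D.
  rewrite D0 cards0 subn0 in cf.
  by apply: leq_trans (subset_leq_card fD); rewrite D0 cf -subSn // leq_subLR; lia.
have [c [cA hc nc]] := DP i iD.
have cm : c - r.*2 < m.
  by have := ltn_ord c; move: hc; rewrite /is_hub [X in _ < X -> _]nE; lia.
have cD : #|D| <= a.
  apply: leq_trans (near_card cm); apply: subset_leq_card.
  apply/subsetP => k kD; rewrite inE; have [c' [c'A hc' nc']] := DP k kD.
  (* Hubs are pairwise adjacent, so an independent set contains at most one. *)
  suff -> : c = c' by []. 
  by have := indA _ _ cA c'A; rewrite e_hub_hub // negbK => /eqP.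
have : #|c |: (f @: (~: D))| <= #|A|.
  by apply: subset_leq_card; rewrite subUset sub1set cA.
rewrite cardsU1 cf; have -> : c \notin (f @: (~: D)).
  by apply/negP => /imsetP[k _ ck]; rewrite ck f_hub in hc.
by apply: leq_trans; rewrite add1n ltnS leq_sub2l.
Qed.

End Construction.

Local Close Scope ring_scope.

(** * Arithmetic of the parameters and the two inclusions *)

Lemma leq_mul_ceil_div a b : 0 < b -> a <= ceil_div a b * b.
Proof.
move=> b_gt0; rewrite /ceil_div; have := divn_eq (a + b.-1) b.
by have := ltn_pmod (a + b.-1) b_gt0; lia.
Qed.

Lemma card_divn_fiber (r a d : nat) : 0 < a -> #|[set i : 'I_r | i %/ a == d]| <= a.
Proof.
move=> a_gt0; pose f (i : 'I_r) : 'I_a := Ordinal (ltn_pmod i a_gt0).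
rewrite -[leqRHS]card_ord -(@card_in_imset _ _ f) ?max_card // => i k.
rewrite !inE => /eqP id /eqP kd [] eq_mod; apply: val_inj => /=.
by rewrite (divn_eq i a) (divn_eq k a) id kd eq_mod.
Qed.

Lemma setA_sub_RV (K : fieldType) (n r v : nat) : setA n r v -> RV K n r v.
Proof.
case=> r_gt0 rn v_gt0; set m := n - 2 * r => v_le.
have m_gt0 : 0 < m by rewrite subn_gt0.
have nE : n = r.*2 + m by rewrite /m; lia.
have ceil_le : r <= ceil_div r m * m by apply: leq_mul_ceil_div.
have ceil_gt0 : 0 < ceil_div r m by case: (ceil_div r m) ceil_le => //; lia.
(* This makes the subtraction in [setA] genuine, so that the bound on [v] yields [ceil_div r m <= a]
   below. *)
have ceil_le_r : ceil_div r m <= r.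
  by rewrite /ceil_div -ltnS ltn_divLR //; nia.
(* Chosen so that the v-number [(r - a).+1] of the construction equals [v]. *)
pose a := r.+1 - v.
have a_gt0 : 0 < a by rewrite /a; lia.
have a_le_r : a <= r by rewrite /a; lia.
(* With groups of [a] legs, [m] hubs are enough to reach all [r] legs. *)
have r_le : r <= m * a.
  by rewrite mulnC (leq_trans ceil_le) // leq_mul2r /a; apply/orP; right; lia.
(* Surplus hubs repeat the last group of legs: a hub without a leg could create a
   larger induced matching. *)
pose near c i := i %/ a == minn c (r.-1 %/ a).
have near_hub i : i < r -> exists2 c, c < m & near c i.
  move=> ir; exists (i %/ a); first by rewrite ltn_divLR // (leq_trans ir).
  by rewrite /near (minn_idPl _) // leq_div2r // -ltnS prednK.
have near_leg c : c < m -> exists2 i, i < r & near c i.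
  move=> _; exists (minn c (r.-1 %/ a) * a); last by rewrite /near mulnK.
  rewrite -[X in _ < X](prednK r_gt0) ltnS (leq_trans _ (leq_trunc_div r.-1 a)) //.
  by rewrite leq_mul2r geq_minr orbT.
have near0 i : i < r -> near 0 i = (i < a).
  by move=> _; rewrite /near min0n -leqn0 -ltnS ltn_divLR // mul1n.
have near_card c : c < m -> #|[set i : 'I_r | near c i]| <= a.
  by move=> _; apply: card_divn_fiber.
exists (@legged_clique n r near); split.
- exact: legged_clique_simple.
- exact: legged_clique_connected nE r_gt0 m_gt0 near_hub.
- exact: legged_clique_reg nE r_gt0 m_gt0 near_leg.
- have -> : v = (r - a).+1 by rewrite /a; lia.
  exact: legged_clique_vnumber nE r_gt0 m_gt0 a_gt0 a_le_r near0 near_card.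
Qed.

Theorem theorem3p5 (K : fieldType) (n : nat) (hn : 3 <= n) :
  (forall r v : nat, setA n r v -> RV K n r v) /\
  (forall r v : nat, RV K n r v -> setB n r v).
Proof.
by split=> r v; [apply: setA_sub_RV | apply: RV_sub_setB].
Qed.
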